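(* Let $d\ge1$, let $\|\cdot\|$ be a norm on $\mathbb{R}^d$ with dual norm $\|\cdot\|_*$, and let $V=\mathbb{R}\times\mathbb{R}^d$, $V^+=\{(t,\mathbf{x}): t\ge\|\mathbf{x}\|\}$, $e=(1,\mathbf{0})$. Let $a=(\tfrac12,\mathbf{a})\in\partial^+V^+$ be a normalized extremal element, $a_\neg=e-a=(\tfrac12,-\mathbf{a})$, and let $\mathbf{a}'\in\mathbb{R}^d$ satisfy $\mathbf{a}'\cdot\mathbf{a}=\tfrac12$ and $\|\mathbf{a}'\|_*=1$. Consider the coherent Lüders's rules $a^\sharp\colon(t,\mathbf{x})\mapsto(t+\mathbf{a}'\cdot\mathbf{x})\,a$ for $a$ and $a_\neg^\sharp\colon(t,\mathbf{x})\mapsto(t-\mathbf{a}'\cdot\mathbf{x})\,a_\neg$ for $a_\neg$, and put $A=a-a_\neg$ and $A\sharp=a^\sharp-a_\neg^\sharp$. Let $b=(\beta,\mathbf{b})$ be an effect (that is, $0\le b\le e$) with $\|\mathbf{b}\|=\tfrac12$, and put $B=b-(e-b)$. Then for every state $\omega$, $$\omega\big((A\sharp) B+B-A\big)\le 2\|\mathbf{b}-\mathbf{a}\|+2\,\mathbf{a}'\cdot\mathbf{b},$$ and this bound is sharp, i.e. equality is attained for some state $\omega$.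
   Context: For $x,y\in V$ write $x\ge y$ iff $x-y\in V^+$. The dual norm is $\|\mathbf{w}\|_*=\sup\{\mathbf{w}\cdot\mathbf{y}:\|\mathbf{y}\|\le1\}$. The order norm on $V$ is $\|x\|=\inf\{r\ge0:-re\le x\le re\}$, and $\partial^+V^+=\{f\in V^+:\|f\|=1\text{ and }(0\le g\le f\text{ implies }g=rf\text{ for some }r\ge0)\}$ (norm meaning order norm here); its elements are of the form $(\tfrac12,\mathbf{f})$ with $\|\mathbf{f}\|=\tfrac12$. A state is a linear functional $\omega\colon V\to\mathbb{R}$ with $\omega(e)=1$ and $\omega(V^+)\subset[0,\infty)$. A coherent Lüders's rule for an effect $f$ is a linear map $\phi\colon V\to V$ with $\phi(V^+)\subset V^+$, $\phi(e)=f$, and $\phi(g)=g$ for every $g\in V^+$ with $g\le f$. $(A\sharp)B$ denotes the linear map $A\sharp$ applied to $B\in V$. *)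

(* Defs.v *)
From mathcomp Require Import all_boot all_order all_algebra.
From mathcomp Require Import classical_sets reals.

Set Implicit Arguments.
Unset Strict Implicit.
Unset Printing Implicit Defensive.

Import Order.TTheory GRing.Theory Num.Theory.

Local Open Scope classical_set_scope.
Local Open Scope ring_scope.

(* The norm on R^d is an arbitrary function N satisfying the axioms below; it
   is unrelated to MathComp-Analysis' canonical norm `|_| on row vectors, which
   is the sup norm. *)
Record is_norm (R : realType) (d : nat) (N : 'rV[R]_d -> R) : Prop := IsNorm {
  is_norm_triangle : forall x y, N (x + y) <= N x + N y;
  is_norm_scale : forall (r : R) x, N (r *: x) = `|r| * N x;
  is_norm_eq0 : forall x, N x = 0 -> x = 0 }.

Definition dot (R : realType) (d : nat) (u v : 'rV[R]_d) : R :=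
  \sum_(i < d) u 0 i * v 0 i.

(* The set is nonempty and, in finite dimension, bounded, so that this is a
   genuine supremum. *)
Definition dual_norm (R : realType) (d : nat) (N : 'rV[R]_d -> R)
    (w : 'rV[R]_d) : R :=
  sup [set dot w y | y in [set y | N y <= 1]].

(* R^o is R seen as a left module over itself: this makes the product a left
   module over R. *)
Notation ospace R d := (R^o * 'rV[R]_d)%type.

Definition ounit (R : realType) (d : nat) : ospace R d := (1, 0).

Definition pcone (R : realType) (d : nat) (N : 'rV[R]_d -> R) :
    set (ospace R d) :=
  [set v | N v.2 <= v.1].

Definition ole (R : realType) (d : nat) (N : 'rV[R]_d -> R)
    (x y : ospace R d) : Prop :=
  pcone N (y - x).

Definition order_norm (R : realType) (d : nat) (N : 'rV[R]_d -> R)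
    (x : ospace R d) : R :=
  inf [set r : R | [/\ 0 <= r, ole N (- (r *: ounit R d)) x
                            & ole N x (r *: ounit R d)]].

Definition normalized_extremal (R : realType) (d : nat) (N : 'rV[R]_d -> R) :
    set (ospace R d) :=
  [set f | [/\ pcone N f, order_norm N f = 1
             & forall g, ole N 0 g -> ole N g f ->
                 exists2 r : R, 0 <= r & g = r *: f]].

Definition is_effect (R : realType) (d : nat) (N : 'rV[R]_d -> R)
    (f : ospace R d) : Prop :=
  ole N 0 f /\ ole N f (ounit R d).

Definition is_state (R : realType) (d : nat) (N : 'rV[R]_d -> R)
    (omega : {scalar ospace R d}) : Prop :=
  omega (ounit R d) = 1 /\ forall v, pcone N v -> 0 <= omega v.

Definition coherent_luders_rule (R : realType) (d : nat) (N : 'rV[R]_d -> R)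
    (f : ospace R d) (phi : ospace R d -> ospace R d) : Prop :=
  [/\ linear phi,
      forall v, pcone N v -> pcone N (phi v),
      phi (ounit R d) = f
    & forall g, pcone N g -> ole N g f -> phi g = g].

(* Main.v *)
Require Import Defs.
From HB Require Import structures.
From mathcomp Require Import all_boot all_order all_algebra.
From mathcomp Require Import classical_sets reals boolp.
From mathcomp Require Import ring lra.

Set Implicit Arguments.
Unset Strict Implicit.
Unset Printing Implicit Defensive.

Import Order.TTheory GRing.Theory Num.Theory.

Local Open Scope classical_set_scope.
Local Open Scope ring_scope.

(** Since [b] is an effect with [N vb = 1/2], necessarily [beta = 1/2], so that
    [B = (0, 2 vb)] and [A# B + B - A = (2 va'.vb, 2 (vb - va))].  A state
    [omega] is [(t, x) |-> t + f x] with [f] linear and [f <= N], which gives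
    the bound, and Hahn-Banach provides an [f] attaining [N] at a given point.

    For Hahn-Banach in finite dimension, a sublinear [p] is lowered
    successively along the vectors of a basis to a sublinear function that is
    odd on the basis; the vectors at which a sublinear function is odd form a
    subspace, on which it is linear. *)

(** * Finite-dimensional Hahn-Banach theorem *)

Definition sublinear (R : realType) (V : lmodType R) (p : V -> R) : Prop :=
  (forall x y, p (x + y) <= p x + p y) /\
  (forall (r : R) x, 0 <= r -> p (r *: x) = r * p x).

(** One inequality suffices for homogeneity: applied to [r^-1] it gives the converse, and
    subadditivity forces [0 <= p 0]. *)
Lemma sublinear_of_le (R : realType) (V : lmodType R) (p : V -> R) :
  (forall x y, p (x + y) <= p x + p y) ->
  p 0 <= 0 ->
  (forall (r : R) x, 0 < r -> p (r *: x) <= r * p x) ->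
  sublinear p.
Proof.
move=> pD p0 pZ; split=> // r x; rewrite le0r => /predU1P[->|r_gt0].
  rewrite scale0r mul0r; apply/le_anti; rewrite p0 /=.
  by have := pD 0 0; rewrite addr0; lra.
apply/le_anti; rewrite pZ //= -ler_pdivlMl //.
have {1}-> : x = r^-1 *: (r *: x) by rewrite scalerA mulVf ?gt_eqF // scale1r.
by apply: pZ; rewrite invr_gt0.
Qed.

Section Sublinear.
Variables (R : realType) (V : lmodType R) (p : V -> R).
Hypothesis p_sublinear : sublinear p.

Lemma sublinear0 : p 0 = 0.
Proof. by rewrite -(scale0r 0) p_sublinear.2 // mul0r. Qed.

Lemma sublinearN_ge (x : V) : - p x <= p (- x).
Proof. by have := p_sublinear.1 x (- x); rewrite subrr sublinear0; lra. Qed.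

Lemma sublinear_odd_scalar :
  (forall x, p (- x) = - p x) -> scalar p.
Proof.
move=> pN; have pD x y : p (x + y) = p x + p y.
  apply/le_anti; rewrite p_sublinear.1 /=.
  by have := p_sublinear.1 (x + y) (- y); rewrite addrK pN; lra.
move=> r x y; rewrite pD; congr (_ + _).
have [/p_sublinear.2//|/ltW r_le0] := leP 0 r.
rewrite -[r]opprK scaleNr pN p_sublinear.2 ?oppr_ge0 //=; ring.
Qed.

(* Sublinearity of the infimum of [p (x + t v) - t p v] over [t >= 0]; at
   [t = 1], [x = - v] it gives linearity along [v]. *)
Lemma sublinear_odd_at (v : V) :
  exists q : V -> R, [/\ sublinear q, forall x, q x <= p x & q (- v) = - p v].
Proof.
pose E x := [set p (x + t *: v) - t * p v | t in [set t : R | 0 <= t]].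
have E_lb x : has_lbound (E x).
  exists (- p (- x)) => _ [t /= t_ge0 <-].
  have := p_sublinear.1 (x + t *: v) (- x).
  by rewrite addrAC subrr add0r p_sublinear.2 //; lra.
have E0 x : E x !=set0 by exists (p (x + 0 *: v) - 0 * p v), 0 => /=.
pose q x := inf (E x).
have q_le x t : 0 <= t -> q x <= p (x + t *: v) - t * p v.
  by move=> t_ge0; apply: ge_inf => //; exists t.
have q_lep x : q x <= p x.
  by have := q_le x 0 (lexx 0); rewrite scale0r addr0 mul0r subr0.
have q_sublinear : sublinear q.
  apply: sublinear_of_le.
  (* The two infima are removed one at a time; parameters [s] for [x] and [t] for [y] combine into
     [s + t] for [x + y]. *)
  - move=> x y; rewrite -lerBlDl; apply: lb_le_inf => // _ [t /= t_ge0 <-].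
    rewrite lerBlDl -lerBlDr; apply: lb_le_inf => // _ [s /= s_ge0 <-].
    have := q_le (x + y) (s + t) (addr_ge0 s_ge0 t_ge0).
    have := p_sublinear.1 (x + s *: v) (y + t *: v).
    by rewrite addrACA -scalerDl; lra.
  - by rewrite -sublinear0.
  (* The parameter [t] for [x] corresponds to [r * t] for [r *: x]. *)
  - move=> r x r_gt0; rewrite -ler_pdivrMl //.
    apply: lb_le_inf => // _ [t /= t_ge0 <-]; rewrite ler_pdivrMl //.
    have := q_le (r *: x) (r * t) (mulr_ge0 (ltW r_gt0) t_ge0).
    by rewrite -scalerA -scalerDr (p_sublinear.2 _ _ (ltW r_gt0)); lra.
exists q; split=> //; apply/le_anti/andP; split.
  by have := q_le (- v) 1 ler01; rewrite scale1r addNr sublinear0; lra.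
(* Conversely, [0 = q 0 <= q v + q (- v) <= p v + q (- v)]. *)
have := q_sublinear.1 v (- v); rewrite subrr.
have -> : q 0 = 0 by rewrite -(scale0r 0) q_sublinear.2 // mul0r.
by have := q_lep v; lra.
Qed.

End Sublinear.

(** Oddness survives further lowering, by the chain [- q v <= q (- v) <= p (- v) = - p v <= - q v].
    This is what permits treating the vectors one after another. *)
Lemma le_sublinear_odd (R : realType) (V : lmodType R) (p q : V -> R) (v : V) :
  sublinear q -> (forall x, q x <= p x) -> p (- v) = - p v ->
  q v = p v /\ q (- v) = - q v.
Proof.
move=> q_sublinear q_le pN.
have := sublinearN_ge q_sublinear v; have := q_le v; have := q_le (- v).
by rewrite pN; split; lra.
Qed.

Lemma sublinear_odd_on (R : realType) (V : lmodType R) (s : seq V)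
    (p : V -> R) : sublinear p ->
  exists q : V -> R, [/\ sublinear q, forall x, q x <= p x
    & forall v, v \in s -> q (- v) = - q v].
Proof.
elim: s p => [|v s IHs] p p_sublinear; first by exists p.
have [p1 [p1_sublinear p1_le p1N]] := sublinear_odd_at p_sublinear v.
have [q [q_sublinear q_le qN]] := IHs p1 p1_sublinear.
exists q; split=> // [x|w]; first exact: le_trans (q_le x) (p1_le x).
rewrite inE => /predU1P[->|]; last exact: qN.
have p1v : p1 (- v) = - p1 v.
  have := sublinearN_ge p1_sublinear v; have := p1_le v.
  by rewrite p1N; lra.
by case: (le_sublinear_odd q_sublinear q_le p1v).
Qed.

Lemma scalar_bundle (R : pzRingType) (V : lmodType R) (f : V -> R) :
  scalar f -> exists g : {scalar V}, g =1 f.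
Proof.
move=> f_scalar; pose H := GRing.isLinear.Build R V R *%R f f_scalar.
pose g : {scalar V} := HB.pack f H.
by exists g.
Qed.

Theorem hahn_banach (R : realType) (V : vectType R) (p : V -> R) (z : V) :
  sublinear p ->
  exists f : {scalar V}, (forall x, f x <= p x) /\ f z = p z.
Proof.
move=> p_sublinear.
(* Lowering along [z] first fixes the value at [- z] to [- p z]; lowering along a basis afterwards
   cannot change the value at [z]. *)
have [p1 [p1_sublinear p1_le p1N]] := sublinear_odd_at p_sublinear z.
have [q [q_sublinear q_le qN]] :=
  sublinear_odd_on (vbasis (@fullv R V)) p1_sublinear.
have qDN x y : q (- x) = - q x -> q (- y) = - q y -> q (- (x + y)) = - q (x + y).
  move=> qx qy; apply/le_anti; rewrite sublinearN_ge // andbT opprD.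
  have := q_sublinear.1 (- x) (- y); have := q_sublinear.1 x y.
  have := q_sublinear.1 (x + y) (- y); have := q_sublinear.1 (- y) (- x).
  by rewrite addrK qx qy; lra.
have q_odd x : q (- x) = - q x.
  rewrite (coord_vbasis (memvf x)).
  elim/big_ind: _ => [|//|i _]; first by rewrite oppr0 sublinear0 ?oppr0.
  set r := coord _ _ _; set v := _`_i.
  have qv : q (- v) = - q v by apply: qN; rewrite mem_nth ?size_tuple.
  (* Homogeneity covers only nonnegative scalars; a negative [r] is moved onto [- v], where oddness
     applies. *)
  have [r_ge0|/ltW r_le0] := leP 0 r.
    by rewrite -scalerN !q_sublinear.2 // qv mulrN.
  rewrite -[r]opprK scaleNr opprK -scalerN !q_sublinear.2 ?oppr_ge0 // qv.
  by rewrite mulrN opprK.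
have [f fE] := scalar_bundle (sublinear_odd_scalar q_sublinear q_odd).
exists f; split=> [x|]; rewrite fE; first exact: le_trans (q_le x) (p1_le x).
have := le_trans (q_le z) (p1_le z); have := q_le (- z).
by rewrite q_odd p1N => *; apply/le_anti/andP; split; lra.
Qed.

(** * The order unit space of a norm *)

Section Norm.
Variables (R : realType) (d : nat) (N : 'rV[R]_d -> R).
Hypothesis N_norm : is_norm N.

Lemma is_norm_sublinear : sublinear N.
Proof.
split=> [|r x r_ge0]; first exact: is_norm_triangle N_norm.
by rewrite (is_norm_scale N_norm) ger0_norm.
Qed.

Lemma is_normN (x : 'rV[R]_d) : N (- x) = N x.
Proof. by rewrite -scaleN1r (is_norm_scale N_norm) normrN1 mul1r. Qed.

Lemma is_norm_ge0 (x : 'rV[R]_d) : 0 <= N x.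
Proof. by have := sublinearN_ge is_norm_sublinear x; rewrite is_normN; lra. Qed.

Lemma dotDr (u v w : 'rV[R]_d) : dot u (v + w) = dot u v + dot u w.
Proof. by rewrite -big_split; apply: eq_bigr => i _; rewrite mxE mulrDr. Qed.

Lemma dotZr (r : R) (u v : 'rV[R]_d) : dot u (r *: v) = r * dot u v.
Proof. by rewrite mulr_sumr; apply: eq_bigr => i _; rewrite mxE mulrCA. Qed.

Lemma dotNr (u v : 'rV[R]_d) : dot u (- v) = - dot u v.
Proof. by rewrite -scaleN1r dotZr mulN1r. Qed.

Lemma dotNl (u v : 'rV[R]_d) : dot (- u) v = - dot u v.
Proof. by rewrite -sumrN; apply: eq_bigr => i _; rewrite mxE mulNr. Qed.

Lemma dotr0 (u : 'rV[R]_d) : dot u 0 = 0.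
Proof. by rewrite -(scale0r 0) dotZr mul0r. Qed.

(* [sup] of an unbounded set is [0], so the hypothesis forces boundedness. *)
Lemma dual_norm1_le (w x : 'rV[R]_d) : dual_norm N w = 1 -> dot w x <= N x.
Proof.
move=> w1; have w_sup : has_sup [set dot w y | y in [set y | N y <= 1]].
  apply: contrapT => /sup_out; rewrite -/(dual_norm N w) w1 => /eqP.
  by rewrite oner_eq0.
have := is_norm_ge0 x; rewrite le0r => /predU1P[Nx0|Nx_gt0].
  by rewrite (is_norm_eq0 N_norm Nx0) dotr0 is_norm_ge0.
rewrite -[N x]mulr1 -ler_pdivrMl // -dotZr -w1.
apply: ub_le_sup; first exact: w_sup.2.
exists ((N x)^-1 *: x) => //=.
by rewrite is_norm_sublinear.2 ?invr_ge0 ?is_norm_ge0 // mulVf ?gt_eqF.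
Qed.

(** Positivity comes from [- dot va' x <= N x], which makes the coefficient nonnegative on the cone.
    By extremality, any [g] between 0 and the effect is a multiple of it, and the effect is fixed
    since its coefficient is 1/2 + 1/2. *)
Lemma coherent_luders_rule_half (va va' : 'rV[R]_d) :
  normalized_extremal N (2^-1, va) -> dot va' va = 2^-1 ->
  (forall x, dot va' x <= N x) ->
  coherent_luders_rule N (2^-1, va)
    (fun v => (v.1 + dot va' v.2) *: ((2^-1, va) : ospace R d)).
Proof.
move=> [va_cone _ va_ext] va'va va'_le; split.
- move=> r x y /=; rewrite dotDr dotZr scalerA -scalerDl; congr (_ *: _).
  by rewrite /GRing.scale /=; ring.
- move=> [t x] /= tx; rewrite /pcone /=.
  have c_ge0 : 0 <= t + dot va' x.
    have := va'_le (- x); rewrite dotNr is_normN.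
    by move: tx; rewrite /pcone /=; lra.
  by rewrite is_norm_sublinear.2 // ler_wpM2l.
- by rewrite /= dotr0 addr0 scale1r.
- move=> g g_cone g_le; have [|r _ ->] := va_ext g _ g_le.
    by rewrite /ole subr0.
  congr (_ *: _); rewrite dotZr va'va; exact: esym (splitr r).
Qed.

(* [e - f] is the reflection [(1/2, - x)] of [f = (1/2, x)], and
   [(t, x) |-> (t, - x)] is an order automorphism fixing [e]. *)
Lemma normalized_extremalN (t : R) (x : 'rV[R]_d) :
  normalized_extremal N (t, x) -> normalized_extremal N (t, - x).
Proof.
move=> [x_cone x_norm x_ext]; split; first by rewrite /pcone /= is_normN.
- rewrite -x_norm /order_norm; congr inf; apply/seteqP.
  rewrite /ole /pcone; split=> r /= [r_ge0];
  rewrite ?scaler0 ?oppr0 ?opprK ?addr0 ?add0r is_normN => H1 H2; split=> //;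
  by rewrite ?scaler0 ?oppr0 ?opprK ?addr0 ?add0r is_normN.
- move=> [s y]; rewrite /ole /pcone /= !subr0 => y_cone y_le.
  have [||r r_ge0 [-> yE]] := x_ext (s, - y).
  + by rewrite /ole /pcone /= !subr0 is_normN.
  + by rewrite /ole /pcone /= -is_normN opprD opprK.
  by exists r => //; congr (_, _); rewrite /= scalerN -yE opprK.
Qed.

Lemma state_le_norm (omega : {scalar ospace R d}) (t : R) (x : 'rV[R]_d) :
  is_state N omega -> omega (t, x) <= t + N x.
Proof.
move=> [omega1 omega_ge0].
(* The subtracted vector lies on the boundary of the cone, so the state is nonnegative there. *)
have -> : (t, x) = (t + N x) *: ounit R d - (N x, - x) :> ospace R d.
  congr (_, _); rewrite /= ?scaler0 ?add0r ?opprK //.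
  by rewrite /GRing.scale /=; ring.
rewrite linearB linearZ /= omega1 mulr1 lerBlDr lerDl.
by apply: omega_ge0; rewrite /pcone /= is_normN.
Qed.

Lemma state_attaining_norm (t : R) (x : 'rV[R]_d) :
  exists omega : {scalar ospace R d}, is_state N omega /\
    omega (t, x) = t + N x.
Proof.
have [f [f_le fx]] := hahn_banach x is_norm_sublinear.
(* Positivity of this functional is [f (- x) <= N x]. *)
have [|omega omegaE] := @scalar_bundle R (ospace R d) (fun v => v.1 + f v.2).
  move=> r u v /=; rewrite linearD linearZ /= /GRing.scale /=; ring.
exists omega; rewrite omegaE fx; split=> //; split=> [|v].
  by rewrite omegaE /= linear0 addr0.
by rewrite /pcone omegaE /=; have := f_le (- v.2); rewrite linearN is_normN; lra.
Qed.

End Norm.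

Theorem mainTheorem3 (R : realType) (d : nat) (d_ge1 : (1 <= d)%N)
    (N : 'rV[R]_d -> R) (N_norm : is_norm N)
    (va : 'rV[R]_d) (a_extremal : normalized_extremal N (2^-1, va))
    (va' : 'rV[R]_d) (va'_dot : dot va' va = 2^-1)
    (va'_norm : dual_norm N va' = 1)
    (beta : R) (vb : 'rV[R]_d) (b_effect : is_effect N (beta, vb))
    (vb_norm : N vb = 2^-1) :
  let e : ospace R d := ounit R d in
  let a : ospace R d := (2^-1, va) in
  let aneg : ospace R d := e - a in
  let a_sharp : ospace R d -> ospace R d :=
    fun v => (v.1 + dot va' v.2) *: a in
  let aneg_sharp : ospace R d -> ospace R d :=
    fun v => (v.1 - dot va' v.2) *: aneg in
  let A : ospace R d := a - aneg in
  let A_sharp : ospace R d -> ospace R d :=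
    fun v => a_sharp v - aneg_sharp v in
  let b : ospace R d := (beta, vb) in
  let B : ospace R d := b - (e - b) in
  [/\ coherent_luders_rule N a a_sharp,
      coherent_luders_rule N aneg aneg_sharp,
      (forall omega : {scalar ospace R d}, is_state N omega ->
         omega (A_sharp B + B - A) <= 2 * N (vb - va) + 2 * dot va' vb)
    & (exists omega : {scalar ospace R d}, is_state N omega /\
         omega (A_sharp B + B - A) = 2 * N (vb - va) + 2 * dot va' vb)].
Proof.
move=> e a aneg a_sharp aneg_sharp A A_sharp b B.
have va'_le x : dot va' x <= N x by exact: dual_norm1_le.
have anegE : aneg = (2^-1, - va).
  by congr (_, _); rewrite /= ?add0r //; lra.
have betaE : beta = 2^-1.
  move: b_effect => []; rewrite /ole /pcone /= !subr0 add0r is_normN // vb_norm.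
  by move=> *; lra.
have goalE : A_sharp B + B - A = (2 * dot va' vb, 2%:R *: (vb - va)).
  have BE : B = (0, 2%:R *: vb).
    congr (_, _); rewrite /= ?betaE; first by lra.
    by rewrite add0r opprK -mulr2n scaler_nat.
  have AE : A = (0, 2%:R *: va).
    rewrite /A anegE; congr (_, _); rewrite /= ?subrr //.
    by rewrite opprK -mulr2n scaler_nat.
  (* The two rules have opposite coefficients at [B], so in [A_sharp B] the scalar parts add up and
     the vector parts cancel. *)
  rewrite /A_sharp /a_sharp /aneg_sharp anegE BE AE /= dotZr add0r sub0r.
  congr (_, _) => /=; first by rewrite /GRing.scale /=; lra.
  by rewrite scaleNr scalerN opprK subrr add0r scalerBr.
have normE : 2 * N (vb - va) + 2 * dot va' vb
    = 2 * dot va' vb + N (2%:R *: (vb - va)).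
  by rewrite (is_norm_sublinear N_norm).2 // addrC.
split.
- exact: coherent_luders_rule_half.
- rewrite anegE.
  (* The rule for [aneg] is the rule for [a] with both [va] and [va'] negated. *)
  have -> : aneg_sharp = fun v => (v.1 + dot (- va') v.2) *: (2^-1, - va).
    by apply/funext => v; rewrite /aneg_sharp anegE dotNl.
  apply: coherent_luders_rule_half => //.
  + exact: normalized_extremalN.
  + by rewrite dotNl dotNr opprK.
  + by move=> x; rewrite dotNl -dotNr -(is_normN N_norm).
- by move=> omega omega_state; rewrite goalE normE; exact: state_le_norm.
- by rewrite goalE normE; exact: state_attaining_norm.
Qed.
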